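(* Let $\mathfrak{G}$ be a group, let $Q_1,\ldots,Q_p$ be finite sets each with a right action of $\mathfrak{G}$, such that all the sets $Q_i$ and $Q_i\times\mathbb{N}$ are pairwise disjoint, and let $\Phi$ be a finite $\mathfrak{G}$-gain graph with vertex set $V$ and $n=|V|$. For nonnegative integers $k_1,\ldots,k_p$ let $$Q_{k_1,\ldots,k_p}:=Q_1\times[k_1]\,\cup\,Q_2\times[k_2]\,\cup\cdots\cup\,Q_p\times[k_p],$$ with $\mathfrak{G}$ acting on the first coordinates. Then the number $\chi_\Phi(Q_{k_1,\ldots,k_p})$ of totally frustrated states of $\Phi$ with spins in $Q_{k_1,\ldots,k_p}$ is given, for all $k_1,\ldots,k_p\in\mathbb{N}$, by the multivariate polynomial $$\chi_{\Phi;Q_1,\ldots,Q_p}(k_1,\ldots,k_p)=\sum_{A\in\mathcal{H}_\Phi}\mu_{\mathcal{H}_\Phi}(\varnothing,A)\prod_{j=1}^m\Big[\sum_{i=1}^p k_i\,|\operatorname{Fix}_i\mathfrak{H}_{A_j}(v_j)|\Big],$$ where $A_1,\ldots,A_m$ denote the connected components of $A$ (including isolated vertices) and $v_j$ is any vertex of $A_j$. If this polynomial is not identically $0$, it has total degree $n$ and its terms of highest degree are those of the expression $$\prod_{v\in V}\ \sum_{i=1}^p k_i\Big[|Q_i|-\Big|\bigcup_{l_v}\operatorname{Fix}_i(\phi(l_v))\Big|\Big],$$ where $l_v$ ranges over all loops incident with $v$.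
   Context: $\mathbb{N}$ is the set of nonnegative integers and $[k]=\{1,\dots,k\}$ (empty if $k=0$). Graphs may have loops and multiple edges. A $\mathfrak{G}$-gain graph $\Phi=(\Gamma,\phi)$ consists of an underlying graph $\Gamma=(V,E)$ and a gain function $\phi$ assigning to each oriented edge an element of $\mathfrak{G}$, with $\phi(e^{-1})=\phi(e)^{-1}$, where $e^{-1}$ is $e$ with the opposite orientation. The gain of a walk is the product of the gains of its edges in the order and direction traversed. For a set $Q$ with a right $\mathfrak{G}$-action, a state is any function $s:V\to Q$; an edge $e$ oriented from $v$ to $w$ (possibly $v=w$) is satisfied in $s$ if $s_w=s_v\phi(e)$ and frustrated otherwise; a state is totally frustrated if every edge is frustrated; $\chi_\Phi(Q)$ is the number of totally frustrated states. For a subgroup $\mathfrak{H}\le\mathfrak{G}$, $\operatorname{Fix}_i\mathfrak{H}$ is the set of elements of $Q_i$ fixed by all of $\mathfrak{H}$; for $g\in\mathfrak{G}$, $\operatorname{Fix}_i(g)$ is the set of elements of $Q_i$ fixed by $g$. Holonomy. For $A\subseteq E$, components of $A$ are the connected components of the spanning subgraph $(V,A)$, including isolated vertices. Let $T$ be a maximal forest in $A$ (a spanning tree in each component). For an edge $e$ with endpoints $v,w$ (possibly equal) in the same component of $A$, and a base vertex $v_0$ in that component, let $W_e$ be the closed walk that goes from $v_0$ to $v$ along $T$, then along $e$ to $w$, then back to $v_0$ along $T$. The holonomy group is $$\mathfrak{H}_A(v_0)=\mathfrak{H}_A(v_0,T)=\langle\phi(W_e): e\in A_0\smallsetminus T\rangle\le\mathfrak{G},$$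 where $A_0$ is the edge set of the component of $A$ containing $v_0$. It does not depend on $T$, and changing $v_0$ within its component conjugates it, so the sizes of its fixed sets do not depend on these choices. For a component consisting of an isolated vertex the holonomy group is trivial, so its factor in the product is $\sum_i k_i|Q_i|$. Let $\operatorname{cl}A$ be $A$ together with all edges whose endpoints are connected in $A$ (in particular, all loops). The holonomy closure of $A$ is $\operatorname{hcl}A=\{e\in\operatorname{cl}A:\phi(W_e)\in\mathfrak{H}_A(v,T)\}$, where $v$ is any vertex of the component of $A$ containing the endpoints of $e$ and $W_e$ is based at $v$; this does not depend on the choices. $A$ is holonomy closed if $\operatorname{hcl}A=A$. $\mathcal{H}_\Phi$ is the class of holonomy-closed edge sets, ordered by inclusion, and $\mu_{\mathcal{H}_\Phi}$ is its Möbius function, with the convention $\mu_{\mathcal{H}_\Phi}(\varnothing,A)=0$ for all $A$ if $\varnothing\notin\mathcal{H}_\Phi$. *)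

(* Defs.v *)
From HB Require Import structures.
From mathcomp Require Import all_boot all_order all_algebra.
From mathcomp Require Import boolp.
From mathcomp.multinomials Require Import mpoly.

Set Implicit Arguments.
Unset Strict Implicit.
Unset Printing Implicit Defensive.

Import GRing.Theory.

Local Open Scope group_scope.

Record right_action (G : groupType) (Q : Type) := RightAction {
  ract :> Q -> G -> Q;
  ract1 : forall q, ract q 1 = q;
  ractM : forall q g h, ract q (g * h) = ract (ract q g) h
}.

Section FixedPoints.
Context (G : groupType) (Q : finType) (a : right_action G Q).

Definition fix_elt (g : G) : {set Q} := [set q | a q g == q].

Definition fix_sub (H : G -> Prop) : {set Q} :=
  [set q | `[< forall h, H h -> a q h = q >]].

End FixedPoints.

(* The subgroup generated by S, as the intersection of all subgroups of G
   containing S. *)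
Definition generated (G : groupType) (S : G -> Prop) (g : G) : Prop :=
  forall K : {pred G}, group_closed K -> (forall x, S x -> x \in K) -> g \in K.

(* The disjoint union of the Q_i x [k_i]; [k] is encoded by 'I_k. *)
Definition spin p (Q : 'I_p -> finType) (k : 'I_p -> nat) : finType :=
  {i : 'I_p & (Q i * 'I_(k i))%type}.

Section SpinAction.
Context (G : groupType) (p : nat) (Q : 'I_p -> finType).
Context (a : forall i, right_action G (Q i)) (k : 'I_p -> nat).

Definition spin_ract (x : spin Q k) (g : G) : spin Q k :=
  Tagged (fun i => (Q i * 'I_(k i))%type)
    (a (tag x) (tagged x).1 g, (tagged x).2).

Lemma spin_ract1 x : spin_ract x 1 = x.
Proof. by case: x => i [q j]; rewrite /spin_ract /= ract1. Qed.

Lemma spin_ractM x g h : spin_ract x (g * h) = spin_ract (spin_ract x g) h.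
Proof. by case: x => i [q j]; rewrite /spin_ract /= ractM. Qed.

Definition spin_action : right_action G (spin Q k) := RightAction spin_ract1 spin_ractM.

End SpinAction.

(* An oriented edge is a pair d : E * bool: (e, false) runs from src e to
   tgt e, and (e, true) is the same edge with the opposite orientation. Thus a
   loop also has two orientations, with mutually inverse gains. *)
Definition rev_edge (E : Type) (d : E * bool) : E * bool := (d.1, ~~ d.2).

Record gain_graph (G : groupType) (V E : Type) := GainGraph {
  src : E -> V;
  tgt : E -> V;
  gain : E * bool -> G;
  gain_rev : forall d, gain (rev_edge d) = (gain d)^-1
}.

Section GainGraph.
Context (G : groupType) (V E : finType) (Phi : gain_graph G V E).
Implicit Types (A T : {set E}) (d : E * bool) (W P : seq (E * bool)).
Implicit Types (e : E) (v w : V).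

Definition etail d : V := if d.2 then tgt Phi d.1 else src Phi d.1.
Definition ehead d : V := if d.2 then src Phi d.1 else tgt Phi d.1.

Section States.
Context (S : finType) (a : right_action G S).

Definition satisfied (s : {ffun V -> S}) d : bool :=
  s (ehead d) == a (s (etail d)) (gain Phi d).

Definition totally_frustrated (s : {ffun V -> S}) : bool :=
  [forall d : E * bool, ~~ satisfied s d].

Definition chi : nat := #|[set s | totally_frustrated s]|.

End States.

Definition adj A : rel V := fun v w =>
  [exists d : E * bool, [&& d.1 \in A, etail d == v & ehead d == w]].

Definition components A : {set {set V}} :=
  equivalence_partition (connect (adj A)) [set: V].

Fixpoint walk v w W : bool :=
  if W is d :: W' then (etail d == v) && walk (ehead d) w W' else v == w.

Definition walk_gain W : G := \prod_(d <- W) gain Phi d.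

(* A circle is a nonempty closed walk with no repeated edge and no repeated
   vertex; it may be a loop or a pair of parallel edges. *)
Definition circle W : Prop :=
  [/\ W <> [::], exists v, walk v v W, uniq (map fst W) & uniq (map etail W)].

Definition is_forest T : Prop :=
  forall W, all (fun d => d.1 \in T) W -> ~ circle W.

Definition maximal_forest A T : Prop :=
  [/\ T \subset A, is_forest T &
      forall T', T \subset T' -> T' \subset A -> is_forest T' -> T' = T].

Definition path_in T v w P : bool :=
  [&& walk v w P, all (fun d => d.1 \in T) P & uniq (v :: map ehead P)].

(* W is the walk W_e based at v0, where e is the edge of d, traversed in the
   direction of d. The paths along the forest T are unique; reversing d
   replaces the gain of W by its inverse. *)
Definition holonomy_walk T v0 d W : Prop :=
  exists P P', [/\ path_in T v0 (etail d) P, path_in T (ehead d) v0 P'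
                 & W = P ++ d :: P'].

Definition holonomy_group A T v0 : G -> Prop :=
  generated (fun g => exists d W,
    [/\ d.1 \in A :\: T, connect (adj A) v0 (etail d),
        holonomy_walk T v0 d W & g = walk_gain W]).

Definition edge_closure A : {set E} :=
  A :|: [set e | connect (adj A) (src Phi e) (tgt Phi e)].

Definition hol_closure A T : {set E} :=
  [set e in edge_closure A | `[< forall v d W,
     d.1 = e -> connect (adj A) v (etail d) -> holonomy_walk T v d W ->
     holonomy_group A T v (walk_gain W) >]].

(* Here T selects a maximal forest in each edge set. *)
Definition hol_closed_sets (T : {set E} -> {set E}) : {set {set E}} :=
  [set A | hol_closure A (T A) == A].

End GainGraph.

Local Open Scope ring_scope.

(* The Moebius function of a family F of finite sets ordered by inclusion,
   computed with fuel; moebius_sum and moebius_out are its defining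
   equations. It vanishes as soon as one argument is not in F. *)
Fixpoint moebius_rec (E : finType) (n : nat) (F : {set {set E}})
    (A B : {set E}) : int :=
  if n is n'.+1 then
    if [&& A \in F, B \in F & A \subset B] then
      if A == B then 1
      else - \sum_(C in F | (A \subset C) && (C \proper B)) moebius_rec n' F A C
    else 0
  else 0.

Definition moebius (E : finType) (F : {set {set E}}) (A B : {set E}) : int :=
  moebius_rec #|B|.+1 F A B.

Lemma moebius_recE (E : finType) n (F : {set {set E}}) (A B : {set E}) :
  (#|B| < n)%N -> moebius_rec n F A B = moebius F A B.
Proof.
rewrite /moebius; have [m] := ubnP #|B|.
elim: m n B => // m IH [|n] B //= ltBm ltBn.
case: ifP => // _; case: ifP => // _; congr (- _).
apply: eq_bigr => C /andP[_ /andP[_ /proper_card ltCB]].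
by rewrite IH ?(leq_trans ltCB) // [RHS]IH // (leq_trans ltCB).
Qed.

Lemma moebius_sum (E : finType) (F : {set {set E}}) (A B : {set E}) :
  A \in F -> B \in F -> A \subset B ->
  \sum_(C in F | (A \subset C) && (C \subset B)) moebius F A C = (A == B)%:R.
Proof.
move=> AF BF sAB; rewrite (bigD1 B) /= ?BF ?sAB ?subxx //.
rewrite {1}/moebius /= AF BF sAB /=.
case: eqP => [<-|_] /=.
  rewrite big1 ?addr0 // => C /andP[/and3P[_ sAC sCA] /negP[]].
  by rewrite eqEsubset sCA sAC.
apply/eqP; rewrite addrC subr_eq0; apply/eqP.
apply: eq_big => [C|C /andP[/and3P[CF sAC sCB] neCB]].
  by rewrite properEneq -!andbA; congr [&& _, _ & _]; rewrite andbC.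
rewrite moebius_recE // proper_card // properEneq neCB //.
Qed.

Lemma moebius_out (E : finType) (F : {set {set E}}) (A B : {set E}) :
  ~~ [&& A \in F, B \in F & A \subset B] -> moebius F A B = 0.
Proof. by rewrite /moebius /= => /negPf->. Qed.

Section ChromaticPolynomial.
Context (G : groupType) (p : nat) (Q : 'I_p -> finType).
Context (a : forall i, right_action G (Q i)).
Context (V E : finType) (Phi : gain_graph G V E).

(* For each edge set A, T A is a maximal forest in A, and B A is a set
   containing one base vertex from each component of A. *)
Definition chi_poly (T : {set E} -> {set E}) (B : {set E} -> {set V}) :
    {mpoly int[p]} :=
  \sum_(A in hol_closed_sets Phi T)
    moebius (hol_closed_sets Phi T) set0 A *:
    \prod_(v in B A) \sum_(i < p)
      (#|fix_sub (a i) (holonomy_group Phi A (T A) v)|%:Z *: 'X_i).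

Definition leading_expr : {mpoly int[p]} :=
  \prod_(v : V) \sum_(i < p)
    ((#|Q i|%:Z
      - #|\bigcup_(e | (src Phi e == v) && (tgt Phi e == v))
            fix_elt (a i) (gain Phi (e, false))|%:Z) *: 'X_i).

End ChromaticPolynomial.

(* Main.v *)
(** For a state s let I(s) be its set of satisfied edges. Following walks of I(s)
    shows that s v is fixed by the holonomy group of I(s) at v, hence that I(s) is
    holonomy closed, so the sum of mu(0, A) over the closed A included in I(s) is
    [I(s) = 0], also when the empty set is not closed. Exchanging summations, the
    number of totally frustrated states is the sum over closed A of mu(0, A) times
    the number of states satisfying A; such a state is determined by its values at
    one vertex per component, which can be any points fixed by the holonomy.

    The terms of degree #|V| come from the sets A made of loops. The same exchange
    with I(s) replaced by its loops, over states valued in the disjoint union of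
    the Q_i and weighted by a product of variables, gives the leading expression.
    If that expression vanishes, the loops at some vertex fix all spins, so there
    is no totally frustrated state for any k and the polynomial is zero. *)

Require Import Defs.
From HB Require Import structures.
From mathcomp Require Import all_boot all_order all_algebra.
From mathcomp Require Import boolp.
From mathcomp.multinomials Require Import mpoly.
From mathcomp Require Import zify.

Set Implicit Arguments.
Unset Strict Implicit.
Unset Printing Implicit Defensive.

Import GRing.Theory.

Local Open Scope group_scope.

(** Used to cut a walk at a repeated vertex or at a repeated edge. *)
Lemma map_nuniqP (X : eqType) (Y : eqType) (f : X -> Y) (s : seq X) :
  ~~ uniq (map f s) ->
  exists s1 x s2 y s3, s = s1 ++ x :: s2 ++ y :: s3 /\ f x = f y.
Proof.
elim: s => //= x s IH; rewrite negb_and negbK => /orP[/mapP[y ys fxy]|].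
  by case/splitPr: ys => s2 s3; exists [::], x, s2, y, s3.
by move=> /IH[s1 [u [s2 [y [s3 [-> ?]]]]]]; exists (x :: s1), u, s2, y, s3.
Qed.

(** * Walks and forests *)

Section Walks.
Context (G : groupType) (V E : finType) (Phi : gain_graph G V E).
Implicit Types (A T : {set E}) (d : E * bool) (W P : seq (E * bool)).
Implicit Types (e : E) (v w : V).

Lemma etail_rev d : etail Phi (rev_edge d) = ehead Phi d.
Proof. by case: d => e []. Qed.

Lemma ehead_rev d : ehead Phi (rev_edge d) = etail Phi d.
Proof. by case: d => e []. Qed.

Lemma eq_or_rev_edge d d' : d.1 = d'.1 -> d' = d \/ d' = rev_edge d.
Proof. by case: d d' => e [] [e' []] /= ->; [left|right|right|left]. Qed.

Lemma adj_edge A d : d.1 \in A -> adj Phi A (etail Phi d) (ehead Phi d).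
Proof. by move=> dA; apply/existsP; exists d; rewrite dA !eqxx. Qed.

Lemma connect_edge A d :
  d.1 \in A -> connect (adj Phi A) (etail Phi d) (ehead Phi d).
Proof. by move=> dA; apply/connect1/adj_edge. Qed.

Lemma adj_sym A : ssrbool.symmetric (adj Phi A).
Proof.
suff adjV v w : adj Phi A v w -> adj Phi A w v by move=> v w; apply/idP/idP; apply: adjV.
case/existsP=> d /and3P[dA /eqP<- /eqP<-].
by rewrite -etail_rev -(ehead_rev d); apply: adj_edge.
Qed.

Lemma connect_adjC A : connect_sym (adj Phi A).
Proof. exact/sym_connect_sym/adj_sym. Qed.

Lemma walk_cat_cons v w W1 d W2 :
  walk Phi v w (W1 ++ d :: W2)
    = walk Phi v (etail Phi d) W1 && walk Phi (ehead Phi d) w W2.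
Proof.
by elim: W1 v => [|d1 W1 IH] v /=; [rewrite eq_sym | rewrite IH andbA].
Qed.

Lemma walk_cat v u w W1 W2 :
  walk Phi v u W1 -> walk Phi u w W2 -> walk Phi v w (W1 ++ W2).
Proof.
elim: W1 v => [|d W1 IH] v /=; first by move=> /eqP->.
by case/andP=> -> /IH{}IH /IH.
Qed.

Lemma walk_gain_cat W1 W2 :
  walk_gain Phi (W1 ++ W2) = walk_gain Phi W1 * walk_gain Phi W2.
Proof. by rewrite /walk_gain big_cat. Qed.

Lemma walk_gain_cons d W : walk_gain Phi (d :: W) = gain Phi d * walk_gain Phi W.
Proof. by rewrite /walk_gain big_cons. Qed.

Lemma walk_gain_nil : walk_gain Phi [::] = 1.
Proof. by rewrite /walk_gain big_nil. Qed.

Lemma connect_walkP A v w :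
  reflect (exists2 W, walk Phi v w W & all (fun d => d.1 \in A) W)
          (connect (adj Phi A) v w).
Proof.
apply: (iffP connectP) => [[p]|[W]].
  elim: p v => [|u p IH] v /= => [_ ->|]; first by exists [::] => /=.
  case/andP=> /existsP[d /and3P[dA /eqP<- /eqP<-]] /IH{}IH /IH[W wW WA].
  by exists (d :: W); rewrite /= ?eqxx ?dA.
elim: W v => [|d W IH] v /=; first by move=> /eqP<-; exists [::].
case/andP=> /eqP<- /IH{}IH /andP[dA /IH[p pp ->]].
by exists (ehead Phi d :: p); rewrite //= adj_edge.
Qed.

Lemma walk_path_in T v w W :
  walk Phi v w W -> all (fun d => d.1 \in T) W -> exists P, path_in Phi T v w P.
Proof.
elim: W v => [|d W IH] v /=.
  by move=> vw _; exists [::]; rewrite /path_in /= vw.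
case/andP=> /eqP dv /IH{}IH /andP[dT /IH[P pP]].
have [vP|vP] := boolP (v \in ehead Phi d :: map (ehead Phi) P); last first.
  exists (d :: P); move: pP; rewrite /path_in /= dv eqxx dT /=.
  by case/and3P=> -> -> -> /=; rewrite vP.
(* The path already visits [v], so everything before that visit is dropped. *)
move: vP; rewrite inE => /orP[/eqP->|/mapP[d' /splitPr d'P ->]]; first by exists P.
case: d'P pP => P1 P2 /and3P[]; rewrite walk_cat_cons all_cat map_cat /= => /andP[_ wP].
case/and3P=> _ _ aP; rewrite cat_uniq => /and4P[_ _ _ uP].
by exists P2; rewrite /path_in wP aP.
Qed.

Lemma connect_path_in T v w :
  connect (adj Phi T) v w -> exists P, path_in Phi T v w P.
Proof. by case/connect_walkP=> W; apply: walk_path_in. Qed.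

(* A shortest counterexample either repeats a vertex, and splits into two
   shorter closed walks, or traverses an edge in both directions, and
   cancelling that edge leaves two shorter closed walks. *)
Lemma forest_closed_gain T v W :
  is_forest Phi T -> walk Phi v v W -> all (fun d => d.1 \in T) W ->
  walk_gain Phi W = 1.
Proof.
move=> fT; have [n] := ubnP (size W); elim: n v W => // n IH v W ltn wW TW.
have [W0|W0] := eqVneq W [::]; first by rewrite W0 walk_gain_nil.
have [uv|/map_nuniqP] := boolP (uniq (map (etail Phi) W)); last first.
  case=> W1 [d1 [W2 [d2 [W3 [defW dd]]]]]; move: wW TW ltn; rewrite {}defW.
  rewrite !walk_cat_cons.
  case/and3P=> w1 w2 w3; rewrite !all_cat /= all_cat /=.
  case/and5P=> a1 ad1 a2 ad2 a3; rewrite !size_cat /= size_cat /= => ltn.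
  have:= IH v (W1 ++ d2 :: W3); rewrite walk_cat_cons -dd w1 w3 all_cat /= a1 ad2 a3.
  rewrite size_cat /= => /(_ _ isT isT) H1.
  have:= IH (etail Phi d1) (d1 :: W2); rewrite /= eqxx dd w2 ad1 a2.
  move=> /(_ _ isT isT) H2.
  by rewrite -cat_cons !walk_gain_cat H2 ?mul1g -?walk_gain_cat ?H1 //; lia.
have [ue|/map_nuniqP] := boolP (uniq (map fst W)).
  have [] := fT W TW; split=> //; first exact/eqP.
  by exists v.
case=> W1 [d1 [W2 [d2 [W3 [defW dd]]]]]; move: wW TW ltn uv; rewrite {}defW.
case: (eq_or_rev_edge dd) => -> {dd d2}.
  (* The same orientation twice would repeat a tail, so the edge is traversed once in each
     direction. *)
  by rewrite map_cat /= map_cat cat_uniq /= mem_cat inE eqxx !orbT !andbF.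
rewrite !walk_cat_cons etail_rev ehead_rev.
case/and3P=> w1 w2 w3; rewrite !all_cat /= all_cat /=.
case/and5P=> a1 ad1 a2 ad2 a3; rewrite !size_cat /= size_cat /= => ltn _.
rewrite walk_gain_cat walk_gain_cons walk_gain_cat walk_gain_cons.
rewrite (IH _ W2 _ w2 a2) ?mul1g ?gain_rev ?mulVKg -?walk_gain_cat; last by lia.
rewrite (IH v (W1 ++ W3)) ?all_cat ?a1 ?(walk_cat w1 w3) //.
by rewrite size_cat; lia.
Qed.

(** If an edge of [A] joined two components of [T], it could be added to [T]: a circle through it,
    cut at that edge, would leave a walk in [T] between its ends. This contradicts maximality. *)
Lemma maximal_forest_connect A T v w :
  maximal_forest Phi A T ->
  connect (adj Phi A) v w = connect (adj Phi T) v w.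
Proof.
case=> sTA fT maxT; apply/idP/idP; last first.
  apply: connect_sub => x y /existsP[d /and3P[dT /eqP<- /eqP<-]].
  exact/connect_edge/(subsetP sTA).
apply: connect_sub => x y /existsP[d /and3P[dA /eqP<- /eqP<-]] {x y v w}.
apply/contraT => ndT.
have ndT' d' : d'.1 = d.1 -> ~~ connect (adj Phi T) (ehead Phi d') (etail Phi d').
  move=> dd; rewrite connect_adjC; case: (eq_or_rev_edge (esym dd)) => -> //.
  by rewrite etail_rev ehead_rev connect_adjC.
suff fT' : is_forest Phi (d.1 |: T).
  have dT : d.1 \in T.
    rewrite -(maxT _ _ _ fT') ?setU11 ?subsetUr //.
    by apply/subsetP=> e; rewrite !inE => /orP[/eqP->|/(subsetP sTA)].
  by rewrite connect_edge in ndT.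
move=> W TW circW; case: (circW) => _ [v wW] uW _.
have [TW'|] := boolP (all (fun d => d.1 \in T) W); first exact: (fT W TW').
case/allPn=> d' d'W d'T; have dd : d'.1 = d.1.
  by have/allP/(_ _ d'W) := TW; rewrite !inE (negPf d'T) orbF => /eqP.
apply: (negP (ndT' _ dd)); case/splitPr: d'W {circW} wW TW uW => W1 W2.
rewrite walk_cat_cons => /andP[w1 w2].
rewrite all_cat /= map_cat cat_uniq /= => /and3P[a1 _ a2].
rewrite negb_or dd => /and4P[_ /andP[n1 _] n2 _].
have inT U : all (fun d0 => d0.1 \in d.1 |: T) U -> d.1 \notin map fst U ->
    all (fun d0 => d0.1 \in T) U.
  move=> aU nU; apply/allP => x xU; have/allP/(_ _ xU) := aU.
  rewrite !inE => /orP[/eqP xd|//]; case/negP: nU; rewrite -xd; exact: map_f.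
apply/connect_walkP; exists (W2 ++ W1); first exact: walk_cat w2 w1.
by rewrite all_cat !inT.
Qed.

End Walks.

(** * Holonomy groups and states *)

Section Holonomy.
Context (G : groupType) (V E : finType) (Phi : gain_graph G V E).
Implicit Types (A T : {set E}) (d : E * bool) (W P : seq (E * bool)).
Implicit Types (e : E) (v w : V).

Lemma generated1 (X : G -> Prop) : generated X 1.
Proof. by move=> K []. Qed.

Lemma mem_generated (X : G -> Prop) g : X g -> generated X g.
Proof. by move=> Xg K _; apply. Qed.

Lemma holonomy_walk_edge A T v d W :
  T \subset A -> holonomy_walk Phi T v d W -> d.1 \in A ->
  walk Phi v v W /\ all (fun d => d.1 \in A) W.
Proof.
move=> sTA [P [P' [/and3P[wP aP _] /and3P[wP' aP' _] ->]]] dA.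
have sall U : all (fun d => d.1 \in T) U -> all (fun d => d.1 \in A) U.
  by apply: sub_all => x /(subsetP sTA).
by rewrite walk_cat_cons wP wP' all_cat /= dA !sall.
Qed.

(** Edges of [T] are covered as well as the generating ones: their walk is closed in the forest, so
    its gain is 1. *)
Lemma holonomy_walk_gain A T v d W :
  maximal_forest Phi A T -> d.1 \in A -> connect (adj Phi A) v (etail Phi d) ->
  holonomy_walk Phi T v d W -> holonomy_group Phi A T v (walk_gain Phi W).
Proof.
case=> sTA fT _ dA vd hW; have [dT|dT] := boolP (d.1 \in T).
  have [wW aW] := holonomy_walk_edge (subxx T) hW dT.
  by rewrite (forest_closed_gain fT wW aW); apply: generated1.
by apply: mem_generated; exists d, W; rewrite !inE dT dA.
Qed.

Lemma sub_hol_closure A T : maximal_forest Phi A T -> A \subset hol_closure Phi A T.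
Proof.
move=> mT; apply/subsetP=> e eA; rewrite !inE eA; apply/asboolP=> v d W de.
by apply: holonomy_walk_gain; rewrite ?de.
Qed.

(** * Satisfied edges and the holonomy closure *)

Section Action.
Context (S : finType) (a : right_action G S).
Implicit Type s : {ffun V -> S}.

Definition satisfied_edges s : {set E} := [set e | satisfied Phi a s (e, false)].

Lemma ract_inj g : injective (a ^~ g).
Proof. by move=> x y /(congr1 (a ^~ g^-1)); rewrite -!ractM mulgV !ract1. Qed.

(** Opposite orientations carry inverse gains, so testing one orientation decides both. *)
Lemma satisfied_edgesE s d : satisfied Phi a s d = (d.1 \in satisfied_edges s).
Proof.
rewrite inE; case: d => e [] //; rewrite /satisfied /etail /ehead /=.
have -> : (e, true) = rev_edge (e, false) by [].
by rewrite gain_rev -(inj_eq (@ract_inj (gain Phi (e, false)))) -ractM mulVg ract1 eq_sym.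
Qed.

Lemma totally_frustratedE s : totally_frustrated Phi a s = (satisfied_edges s == set0).
Proof.
apply/forallP/eqP => [frs|s0 d]; last by rewrite satisfied_edgesE s0 inE.
by apply/setP=> e; rewrite !inE; apply/negbTE/frs.
Qed.

Lemma walk_state A s v w W :
  A \subset satisfied_edges s ->
  walk Phi v w W -> all (fun d => d.1 \in A) W -> s w = a (s v) (walk_gain Phi W).
Proof.
move=> sA; elim: W v => [|d W IH] v /=; first by move=> /eqP->; rewrite walk_gain_nil ract1.
case/andP=> /eqP<- /IH{}IH /andP[/(subsetP sA) dA /IH->].
by move: dA; rewrite -satisfied_edgesE => /eqP->; rewrite walk_gain_cons ractM.
Qed.

(** The stabilizer of [s v] is a subgroup, and it contains the generators because a closed walk of
    satisfied edges carries [s v] back to itself. *)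
Lemma holonomy_fix A T s v :
  T \subset A -> A \subset satisfied_edges s ->
  s v \in fix_sub a (holonomy_group Phi A T v).
Proof.
move=> sTA sA; rewrite inE; apply/asboolP=> h Hh.
suff : h \in [pred g | a (s v) g == s v] by rewrite inE => /eqP.
apply: Hh => [|g [d [W [dAT _ hW ->]]]].
  split=> [|g k]; rewrite !inE ?ract1 // => /eqP ag /eqP ak.
  by rewrite ractM ag -{1}ak -ractM mulgV ract1.
have dA : d.1 \in A by case/setDP: dAT.
have [wW aW] := holonomy_walk_edge sTA hW dA.
by rewrite inE -(walk_state sA wW aW).
Qed.

(** For a new edge, base the holonomy walk at its tail: the edge, then a path [P] of [T] back. Its
    gain fixes the state at the tail, and [P] carries the state at the head to that same value;
    cancelling the gain of [P] shows that the edge is satisfied. *)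
Lemma hol_closure_satisfied A T s :
  maximal_forest Phi A T -> A \subset satisfied_edges s ->
  hol_closure Phi A T \subset satisfied_edges s.
Proof.
move=> mT sA; have [sTA _ _] := mT; apply/subsetP=> e.
rewrite in_set => /andP[clA /asboolP hole]; pose d := (e, false).
have [/(subsetP sA)//|eA] := boolP (e \in A).
have /connect_path_in[P pP] : connect (adj Phi T) (ehead Phi d) (etail Phi d).
  rewrite -(maximal_forest_connect _ _ mT) connect_adjC.
  by move: clA; rewrite !inE (negPf eA).
have /(hole _ d (d :: P) (erefl e) (connect0 _ _)) :
    holonomy_walk Phi T (etail Phi d) d (d :: P).
  by exists [::], P; rewrite /path_in /= eqxx.
have:= holonomy_fix (etail Phi d) sTA sA; rewrite !inE => /asboolP fx /fx.
have /and3P[wP aP _] := pP.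
have aPA : all (fun d => d.1 \in A) P by apply: sub_all aP => x /(subsetP sTA).
rewrite walk_gain_cons ractM {2}(walk_state sA wP aPA) => /ract_inj.
by rewrite /satisfied => ->.
Qed.

Lemma satisfied_edges_closed s T :
  maximal_forest Phi (satisfied_edges s) T ->
  hol_closure Phi (satisfied_edges s) T = satisfied_edges s.
Proof.
by move=> mT; apply/eqP; rewrite eqEsubset hol_closure_satisfied // sub_hol_closure.
Qed.

(** * Counting the states that satisfy a given edge set *)

Section Counting.
Variables (A T : {set E}) (B : {set V}).
Hypothesis mT : maximal_forest Phi A T.
Hypothesis trB : is_transversal B (components Phi A) [set: V].

Lemma transversal_rep : exists rep : V -> V,
  [/\ forall v, rep v \in B, forall v, connect (adj Phi A) (rep v) v
    & forall b v, b \in B -> connect (adj Phi A) b v -> rep v = b].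
Proof.
have eqA : {in [set: V] & &, equivalence_rel (connect (adj Phi A))}.
  move=> x y z _ _ _; split=> [|xy]; first exact: connect0.
  exact: (same_connect (@connect_adjC _ _ _ _ _)).
pose rep v := transversal_repr v B (pblock (components Phi A) v).
have pb v : pblock (components Phi A) v \in components Phi A.
  by apply: pblock_mem; rewrite (cover_partition (equivalence_partitionP eqA)).
have repB v : rep v \in B by apply: (repr_mem_transversal trB).
have repC v : connect (adj Phi A) (rep v) v.
  rewrite connect_adjC -(pblock_equivalence_partition eqA) ?inE //.
  exact: (repr_mem_pblock trB).
have [_ tiP _] := and3P (equivalence_partitionP eqA).
have pbE x y : connect (adj Phi A) x y ->
    pblock (components Phi A) y = pblock (components Phi A) x.
  by move=> xy; apply: same_pblock => //; rewrite pblock_equivalence_partition ?inE.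
exists rep; split=> // b v bB bv.
by apply: (pblock_inj trB) => //; rewrite -(pbE _ _ bv) (pbE _ _ (repC v)).
Qed.

(* A state satisfying A is determined by its values at the base vertices, and
   a value there propagates along T consistently iff it is fixed by the holonomy. *)
Lemma extend_state (rep : V -> V) (t : V -> S) :
  (forall v, connect (adj Phi A) (rep v) v) ->
  (forall v w, connect (adj Phi A) v w -> rep v = rep w) ->
  (forall v, t (rep v) \in fix_sub a (holonomy_group Phi A T (rep v))) ->
  exists2 s, A \subset satisfied_edges s & forall b, rep b = b -> s b = t b.
Proof.
move=> repC repE fixt; have [sTA fT _] := mT.
have /choice[P pP] : forall w, exists P, path_in Phi T (rep w) w P.
  by move=> w; apply: connect_path_in; rewrite -(maximal_forest_connect _ _ mT).
have wP w : walk Phi (rep w) w (P w) by case/and3P: (pP w).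
have aP w : all (fun d => d.1 \in T) (P w) by case/and3P: (pP w).
exists [ffun w => a (t (rep w)) (walk_gain Phi (P w))] => [|b rb]; last first.
  have wb : walk Phi b b (P b) by rewrite -{1}rb.
  by rewrite ffunE (forest_closed_gain fT wb (aP b)) ract1 rb.
apply/subsetP=> e eA; rewrite inE; set d := (e, false).
have repd : rep (ehead Phi d) = rep (etail Phi d).
  by apply/esym/repE/connect_edge.
rewrite /satisfied !ffunE repd; set r := rep (etail Phi d).
have /connect_path_in[P' pP'] : connect (adj Phi T) (ehead Phi d) r.
  by rewrite -(maximal_forest_connect _ _ mT) /r -repd connect_adjC.
have hW : holonomy_walk Phi T r d (P (etail Phi d) ++ d :: P').
  by exists (P (etail Phi d)), P'; split; first exact: pP.
have := fixt (etail Phi d); rewrite inE.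
move=> /asboolP/(_ _ (holonomy_walk_gain (d := d) mT eA (repC _) hW)).
rewrite walk_gain_cat walk_gain_cons !ractM => tr.
(* Compare both values after acting along [P']: the route through [d] becomes a holonomy walk at
   [r], the other a closed walk in the forest, so both give [t r]. *)
apply/eqP/(@ract_inj (walk_gain Phi P')); rewrite tr -ractM -walk_gain_cat.
case/and3P: pP' => wP' aP' _; have := wP (ehead Phi d); rewrite repd => wP1.
by rewrite (forest_closed_gain fT (walk_cat wP1 wP')) ?ract1 // all_cat aP.
Qed.

Lemma card_satisfying :
  #|[set s | A \subset satisfied_edges s]|
    = (\prod_(b in B) #|fix_sub a (holonomy_group Phi A T b)|)%N.
Proof.
have [sTA _ _] := mT; have [rep [repB repC repE]] := transversal_rep.
(* A state is recorded by its restriction to [B]. The option type supplies a default value outside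
   [B] even when [S] is empty. *)
pose F v := [set Some x | x in fix_sub a (holonomy_group Phi A T v)].
pose r s := [ffun v => if v \in B then Some (s v) else None].
have -> : #|[set s | A \subset satisfied_edges s]| = #|pfamily None B F|.
  rewrite -(@card_in_imset _ _ r) => [|s1 s2]; last first.
    rewrite !inE => sA1 sA2 /ffunP r12; apply/ffunP=> v.
    have /connect_walkP[W wW aW] := repC v.
    rewrite (walk_state sA1 wW aW) (walk_state sA2 wW aW).
    by have:= r12 (rep v); rewrite !ffunE repB => -[->].
  apply: eq_card => f; apply/imsetP/pfamilyP.
    case=> s; rewrite inE => sA ->; split=> [|v vB].
      by apply/supportP=> v /negPf vB; rewrite ffunE vB.
    by rewrite ffunE vB; apply/imset_f/holonomy_fix.
  case=> /supportP f0 fF.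
  have /choice[t Ht] : forall v, exists x, f (rep v) = Some x.
    by move=> v; have /imsetP[x _ ->] := fF _ (repB v); exists x.
  have repK b : b \in B -> rep b = b by move=> bB; apply: repE.
  have [||s sA st] := @extend_state rep t repC.
  - move=> v w vw; apply/esym/repE => //; exact: connect_trans (repC v) vw.
  - move=> v; have /imsetP[x xF] := fF _ (repB v).
    by have:= Ht (rep v); rewrite (repK _ (repB v)) => -> [->].
  exists s; first by rewrite inE.
  apply/ffunP=> v; rewrite ffunE; case: ifPn => [vB|/f0 //].
  by rewrite (st _ (repK _ vB)) -Ht repK.
rewrite card_pfamily foldrE big_image; apply: eq_bigr => v _.
by rewrite card_imset // => x y [].
Qed.

End Counting.
End Action.
End Holonomy.

Local Close Scope group_scope.
Local Open Scope ring_scope.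

(** * Polynomials vanishing at all natural numbers, and Moebius sums *)

Section IdentityPrinciple.
Import Num.Theory.

(** The remainder modulo [D] gives the lowest digit and the quotient gives the others. *)
Lemma digits_inj n D (u v : 'I_n -> nat) :
  (forall i, u i < D)%N -> (forall i, v i < D)%N ->
  (\sum_i u i * D ^ i = \sum_i v i * D ^ i)%N -> u =1 v.
Proof.
elim: n u v => [|n IH] u v ltu ltv; first by move=> _ [].
have D0 : (0 < D)%N := leq_trans (ltn0Sn _) (ltu ord0).
have split_digit (w : 'I_n.+1 -> nat) : (\sum_i w i * D ^ i
    = (\sum_(i < n) w (lift ord0 i) * D ^ i) * D + w ord0)%N.
  rewrite big_ord_recl muln1 addnC big_distrl; congr (_ + _)%N.
  by apply: eq_bigr => i _; rewrite /= /bump add1n expnSr mulnA.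
rewrite !split_digit => eqD.
have eq0 : u ord0 = v ord0.
  by have := congr1 (modn^~ D) eqD; rewrite !modnMDl !modn_small.
have /IH{}IH : (\sum_(i < n) u (lift ord0 i) * D ^ i
    = \sum_(i < n) v (lift ord0 i) * D ^ i)%N.
  by have := congr1 (divn^~ D) eqD; rewrite !divnMDl // !divn_small ?addn0.
by move=> i; case: (unliftP ord0 i) => [j|] -> //; apply: IH.
Qed.

Lemma poly_nat_eq0 (q : {poly int}) : (forall t : nat, q.[t%:Z] = 0) -> q = 0.
Proof.
move=> q0; apply/eqP/contraT => nzq.
(* A nonzero polynomial has fewer than [size q] distinct roots. *)
pose rs := [seq t%:Z | t <- iota 0 (size q)].
have : (size rs < size q)%N.
  apply: max_poly_roots => //; first by apply/allP=> _ /mapP[t _ ->]; apply/eqP/q0.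
  by rewrite map_inj_uniq ?iota_uniq // => x y [].
by rewrite size_map size_iota ltnn.
Qed.

(* Kronecker substitution: along k_i = t ^ (D ^ i), with D above all exponents,
   distinct monomials become distinct powers of t. *)
Lemma mpoly_nat_eq0 n (P : {mpoly int[n]}) :
  (forall k : 'I_n -> nat, P.@[fun i => (k i)%:Z] = 0) -> P = 0.
Proof.
move=> P0; pose D := msize P; pose e (m : 'X_{1..n}) := (\sum_i m i * D ^ i)%N.
have e_inj : {in msupp P &, injective e}.
  move=> m m' mP m'P /digits_inj; have lt m0 : m0 \in msupp P -> forall i, (m0 i < D)%N.
    by move=> /msize_mdeg_lt m0P i; apply: leq_ltn_trans m0P; rewrite mdegE (bigD1 i) //= leq_addr.
  by move=> /(_ (lt _ mP) (lt _ m'P)) /mnmP.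
have q0 : \sum_(m <- msupp P) P@_m *: 'X^(e m) = 0 :> {poly int}.
  apply: poly_nat_eq0 => t; rewrite -[RHS](P0 (fun i => t ^ (D ^ i))%N) mevalE horner_sum.
  apply: eq_bigr => m _; rewrite hornerZ hornerXn /e -prodrXr; congr (_ * _).
  by apply: eq_bigr => i _; rewrite mulnC exprM -[in RHS]natz natrX natz.
apply/mpolyP=> m; rewrite mcoeff0; have [mP|/memN_msupp_eq0//] := boolP (m \in msupp P).
have := congr1 (fun q : {poly int} => q`_(e m)) q0; rewrite coef0 coef_sum => <-.
rewrite (bigD1_seq m) //= big_seq_cond big1 => [|m' /andP[m'P nem]].
  by rewrite coefZ coefXn eqxx mulr1 addr0.
rewrite coefZ coefXn; case: eqP => [/e_inj mm'|]; last by rewrite mulr0.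
by rewrite (mm' mP m'P) eqxx in nem.
Qed.

End IdentityPrinciple.

(** When the empty set is not in [F], [J] is nonempty and every Moebius value is 0, so both sides
    vanish. *)
Lemma moebius_sum_set0 (E : finType) (F : {set {set E}}) (J : {set E}) :
  J \in F -> \sum_(A in F | A \subset J) moebius F set0 A = (J == set0)%:R.
Proof.
move=> JF; have [F0|F0] := boolP (set0 \in F).
  rewrite eq_sym -(moebius_sum F0 JF (sub0set J)).
  by apply: eq_bigl => A; rewrite sub0set.
case: eqP JF => [->|_ _]; first by rewrite (negPf F0).
by rewrite big1 // => A _; rewrite moebius_out // (negPf F0).
Qed.

(** After exchanging the sums, each [x] contributes [f x] times a Moebius sum below [I x :&: L].
    Taking for [L] all edges and weight 1 counts the totally frustrated states; taking the loops and
    monomial weights gives the top-degree part. *)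
Lemma moebius_count (E X : finType) (R : zmodType) (F : {set {set E}})
    (I : X -> {set E}) (L : {set E}) (f : X -> R) :
  (forall x, I x :&: L \in F) ->
  \sum_(A in F | A \subset L) (\sum_(x | A \subset I x) f x) *~ moebius F set0 A
    = \sum_(x | I x :&: L == set0) f x.
Proof.
move=> IF; under eq_bigr => A _ do rewrite mulrz_suml.
rewrite (exchange_big_dep xpredT) //= [RHS]big_mkcond /=; apply: eq_bigr => x _.
transitivity (f x *~ (I x :&: L == set0)%:R); last by case: eqP.
rewrite -(moebius_sum_set0 (IF x)) mulrz_sumr.
by apply: eq_bigl => A; rewrite subsetI andbA andbAC.
Qed.

(** * Spins and loops *)

Section Spins.
Context (G : groupType) (p : nat) (Q : 'I_p -> finType).
Context (a : forall i, right_action G (Q i)) (k : 'I_p -> nat).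
Implicit Type x : spin Q k.

Lemma spin_action_fixed x g :
  (spin_action a k x g == x) = (a (tag x) (tagged x).1 g == (tagged x).1).
Proof.
case: x => i [q j]; rewrite -tag_eqE /tag_eq /= eqxx tagged_asE /=.
by rewrite xpair_eqE eqxx andbT.
Qed.

Lemma spin_fix_sub H x :
  (x \in fix_sub (spin_action a k) H) = ((tagged x).1 \in fix_sub (a (tag x)) H).
Proof.
rewrite !inE; apply/asboolP/asboolP => fx h /fx /eqP.
  by rewrite spin_action_fixed => /eqP.
by rewrite -spin_action_fixed => /eqP.
Qed.

(** The weight sees only the index of a spin. With weight 1 this counts spins, with weight ['X_i] it
    produces the linear factors. *)
Lemma sum_spin (R : zmodType) (D : forall i, {set Q i}) (f : 'I_p -> R) :
  \sum_(x : spin Q k | (tagged x).1 \in D (tag x)) f (tag x)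
    = \sum_(i < p) f i *+ (#|D i| * k i).
Proof.
rewrite -(sig_big_dep xpredT (fun i (y : Q i * 'I_(k i)) => y.1 \in D i) (fun i _ => f i)).
apply: eq_bigr => i _; rewrite sumr_const; congr (_ *+ _).
rewrite -[k i in RHS]card_ord -cardX; apply: eq_card => y.
by rewrite !inE andbT.
Qed.

Lemma card_spin_fix_sub H :
  #|fix_sub (spin_action a k) H|%:Z = \sum_(i < p) #|fix_sub (a i) H|%:Z * (k i)%:Z.
Proof.
rewrite -natz -sumr_const (eq_bigl _ _ (@spin_fix_sub H)).
rewrite (sum_spin (fun i => fix_sub (a i) H) (fun=> 1)).
by apply: eq_bigr => i _; rewrite natrM !natz.
Qed.

End Spins.

Section Loops.
Context (G : groupType) (V E : finType) (Phi : gain_graph G V E).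
Implicit Types (A T : {set E}) (v w : V).

Definition loops : {set E} := [set e | src Phi e == tgt Phi e].

Lemma connect_loops A v w : A \subset loops -> connect (adj Phi A) v w = (v == w).
Proof.
move=> sAL; apply/idP/eqP => [|->]; last exact: connect0.
case/connectP=> q; elim: q v => [|u q IH] v /=; first by [].
case/andP=> /existsP[[e b] /and3P[/(subsetP sAL) + /eqP<- /eqP eu]] /IH{}IH /IH <-.
by rewrite -eu inE /etail /ehead /= => /eqP->; case: b {eu}.
Qed.

Lemma hol_closure_loops A T : A \subset loops -> hol_closure Phi A T \subset loops.
Proof.
move=> sAL; apply/subsetP=> e; rewrite inE => /andP[+ _].
by rewrite !inE connect_loops // => /orP[/(subsetP sAL)|//]; rewrite inE.
Qed.

(** An edge that is not a loop puts two vertices in one component, which has a single base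
    vertex. *)
Lemma transversal_full A (B : {set V}) :
  is_transversal B (components Phi A) [set: V] ->
  (B == [set: V]) = (A \subset loops).
Proof.
case/transversal_rep=> rep [repB repC repE]; apply/eqP/subsetP => [BV e eA|sAL].
  have cst := connect_edge Phi (d := (e, false)) eA.
  have inB v : v \in B by rewrite BV inE.
  have := repE _ _ (inB _) cst; rewrite (repE _ _ (inB _) (connect0 _ _)).
  by rewrite inE /etail /ehead /= => ->.
apply/setP=> v; rewrite inE; have := repC v; rewrite connect_loops; last exact/subsetP.
by move/eqP => <-; apply: repB.
Qed.

(** Since the term of [A] has degree [#|B A|], this identifies the terms of degree [#|V|]. *)
Lemma card_transversal_full A (B : {set V}) :
  is_transversal B (components Phi A) [set: V] ->
  (#|B| == #|V|) = (A \subset loops).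
Proof.
move/transversal_full => <-; rewrite -cardsT [RHS]eqEcard subsetT.
by rewrite eqn_leq subset_leq_card ?subsetT.
Qed.

Section Action.
Context (S : finType) (a : right_action G S).

Lemma satisfied_loops_closed (s : {ffun V -> S}) T :
  maximal_forest Phi (satisfied_edges Phi a s :&: loops) T ->
  hol_closure Phi (satisfied_edges Phi a s :&: loops) T
    = satisfied_edges Phi a s :&: loops.
Proof.
move=> mT; apply/eqP; rewrite eqEsubset sub_hol_closure // andbT subsetI.
by rewrite (hol_closure_satisfied mT) ?subsetIl // hol_closure_loops ?subsetIr.
Qed.

Lemma satisfied_loop (s : {ffun V -> S}) e :
  e \in loops ->
  (e \in satisfied_edges Phi a s)
    = (s (src Phi e) \in fix_elt a (gain Phi (e, false))).
Proof. by rewrite !inE /satisfied /etail /ehead /= eq_sym => /eqP->; rewrite eq_sym. Qed.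

(** The components are single vertices, so the condition splits into independent conditions at the
    vertices. This matches the expansion of a product over [V]. *)
Lemma loops_satisfied A T (s : {ffun V -> S}) :
  maximal_forest Phi A T -> A \subset loops ->
  (A \subset satisfied_edges Phi a s)
    = [forall v, s v \in fix_sub a (holonomy_group Phi A T v)].
Proof.
move=> mT sAL; have [sTA _ _] := mT.
apply/idP/forallP => [sA v|fs]; first exact: holonomy_fix.
apply/subsetP=> e eA; rewrite satisfied_loop ?(subsetP sAL) //; pose d := (e, false).
(* Both tree paths are empty: the holonomy walk of a loop is the loop itself. *)
have hW : holonomy_walk Phi T (src Phi e) d [:: d].
  exists [::], [::]; rewrite /path_in /= !eqxx; split=> //.
  by have := subsetP sAL _ eA; rewrite inE eq_sym /ehead /= => ->.
have:= holonomy_walk_gain (d := d) mT eA (connect0 _ _) hW.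
have := fs (src Phi e); rewrite !inE => /asboolP fe /fe.
by rewrite walk_gain_cons walk_gain_nil mulg1 => /eqP.
Qed.

End Action.
End Loops.

Lemma dhomog_prod_card n (R : comNzRingType) (I : finType) (D : {set I})
    (f : I -> {mpoly R[n]}) :
  (forall i, f i \is 1.-homog) -> \prod_(i in D) f i \is #|D|.-homog.
Proof.
move=> f1; rewrite -sum1_card.
apply: (big_rec2 (fun (q : {mpoly R[n]}) d => q \is d.-homog)); first exact: dhomog1.
by move=> i d q _ hq; apply: dhomogM.
Qed.

(** * The chromatic polynomial *)

Section ChromaticPolynomial.
Context (G : groupType) (p : nat) (Q : 'I_p -> finType).
Context (a : forall i, right_action G (Q i)).
Context (V E : finType) (Phi : gain_graph G V E).
Variables (T : {set E} -> {set E}) (B : {set E} -> {set V}).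
Hypothesis hT : forall A, maximal_forest Phi A (T A).
Hypothesis hB : forall A, is_transversal (B A) (components Phi A) [set: V].

(** This is [moebius_count] with [L] the full edge set; [card_satisfying] evaluates the inner
    sums. *)
Lemma chi_poly_eval (k : 'I_p -> nat) :
  (chi_poly a Phi T B).@[fun i => (k i)%:Z] = (chi Phi (spin_action a k))%:Z.
Proof.
pose b := spin_action a k.
have IF (s : {ffun V -> spin Q k}) :
    satisfied_edges Phi b s :&: [set: E] \in hol_closed_sets Phi T.
  by rewrite setIT inE satisfied_edges_closed.
have -> : (chi Phi b)%:Z
    = \sum_(s | satisfied_edges Phi b s :&: [set: E] == set0) 1.
  rewrite sumr_const natz; congr (_%:Z); apply: eq_card => s.
  by rewrite inE totally_frustratedE unfold_in setIT.
rewrite -(moebius_count _ IF) /chi_poly raddf_sum /=.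
rewrite [RHS](eq_bigl (mem (hol_closed_sets Phi T))) => [|A]; last by rewrite subsetT andbT.
apply: eq_bigr => A _; rewrite mevalZ -mulrzr intz mulrC; congr (_ * _).
rewrite sumr_const natz; have := card_satisfying b (hT A) (hB A).
rewrite cardsE => ->; rewrite -natz natr_prod rmorph_prod.
apply: eq_bigr => v _; rewrite natz card_spin_fix_sub raddf_sum.
by apply: eq_bigr => i _; rewrite /= mevalZ mevalXU.
Qed.

Definition loop_fixed i v : {set Q i} :=
  \bigcup_(e | (src Phi e == v) && (tgt Phi e == v))
    fix_elt (a i) (gain Phi (e, false)).

Lemma loops_frustrated (k : 'I_p -> nat) (s : {ffun V -> spin Q k}) :
  (satisfied_edges Phi (spin_action a k) s :&: loops Phi == set0)
    = [forall v, (tagged (s v)).1 \in ~: loop_fixed (tag (s v)) v].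
Proof.
have fixE e : (s (src Phi e) \in fix_elt (spin_action a k) (gain Phi (e, false)))
    = ((tagged (s (src Phi e))).1
         \in fix_elt (a (tag (s (src Phi e)))) (gain Phi (e, false))).
  by rewrite !inE spin_action_fixed.
apply/eqP/forallP => [s0 v|frs].
  rewrite inE; apply/negP=> /bigcupP[e /andP[/eqP ev /eqP ve]].
  have := fixE e; rewrite ev => <- fe.
  have eL : e \in loops Phi by rewrite inE ev ve.
  have : e \in satisfied_edges Phi (spin_action a k) s :&: loops Phi.
    by rewrite inE eL satisfied_loop // ev fe.
  by rewrite s0 inE.
apply/setP=> e; rewrite [RHS]inE inE; apply/negP=> /andP[+ eL].
rewrite satisfied_loop // fixE => fe.
have := frs (src Phi e); rewrite inE => /negP; apply; apply/bigcupP; exists e => //.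
by rewrite eqxx; move: eL; rewrite inE eq_sym.
Qed.

Lemma leading_exprE : leading_expr a Phi
  = \prod_v \sum_(i < p) 'X_i *+ #|~: loop_fixed i v|.
Proof.
apply: eq_bigr => v _; apply: eq_bigr => i _.
rewrite -[#|Q i|](cardsC (loop_fixed i v)) PoszD addrC addKr.
by rewrite -scaler_nat natz.
Qed.

Let linear_factor A v : {mpoly int[p]} :=
  \sum_(i < p) (#|fix_sub (a i) (holonomy_group Phi A (T A) v)|%:Z *: 'X_i).

Lemma linear_factor_homog A v : linear_factor A v \is 1.-homog.
Proof.
by rewrite rpred_sum // => i _; rewrite rpredZ // dhomogX /= mdeg1.
Qed.

Lemma chi_poly_term_homog A : \prod_(v in B A) linear_factor A v \is #|B A|.-homog.
Proof. by apply: dhomog_prod_card => v; apply: linear_factor_homog. Qed.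

Lemma pihomog_chi_poly :
  pihomog mdeg #|V| (chi_poly a Phi T B) = leading_expr a Phi.
Proof.
(* With one copy of each [Q i], the coefficient of ['X_i] in a vertex factor counts spins, so
   choosing one spin in every factor amounts to choosing a state. *)
pose k (i : 'I_p) := 1%N; pose b := spin_action a k.
have IF (s : {ffun V -> spin Q k}) :
    satisfied_edges Phi b s :&: loops Phi \in hol_closed_sets Phi T.
  by rewrite inE satisfied_loops_closed.
pose f (s : {ffun V -> spin Q k}) : {mpoly int[p]} := \prod_v 'X_(tag (s v)).
transitivity (\sum_(s | satisfied_edges Phi b s :&: loops Phi == set0) f s).
  rewrite -(moebius_count f IF) /chi_poly raddf_sum big_mkcondr /=.
  apply: eq_bigr => A _; rewrite linearZ /= -(card_transversal_full (hB A)).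
  case: eqP => [cardB|/eqP cardB]; last first.
    by rewrite (pihomog_ne0 cardB (chi_poly_term_homog A)) scaler0.
  have [sAL BV] : A \subset loops Phi /\ B A = [set: V].
    rewrite -(card_transversal_full (hB A)) cardB eqxx; split=> //.
    by apply/eqP; rewrite (transversal_full (hB A)) -(card_transversal_full (hB A)) cardB.
  rewrite pihomog_dE -?cardB ?chi_poly_term_homog // -scaler_int intz; congr (_ *: _).
  rewrite BV (eq_bigl xpredT) => [|v]; last by rewrite inE.
  (* Distributing the product over the sums indexes the result by the states satisfying [A]. *)
  transitivity (\prod_v \sum_(x in fix_sub b (holonomy_group Phi A (T A) v)) 'X_(tag x) :
      {mpoly int[p]}); last first.
    rewrite bigA_distr_big_dep; apply: eq_bigl => s.
    by rewrite (loops_satisfied b s (hT A) sAL); apply/familyP/forallP.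
  apply: eq_bigr => v _; rewrite (eq_bigl _ _ (@spin_fix_sub _ _ _ a k _)).
  apply/esym; apply: etrans (sum_spin k (fun i => fix_sub (a i) _) (fun i => 'X_i)) _.
  by apply: eq_bigr => i _; rewrite muln1 -scaler_nat natz.
rewrite leading_exprE (eq_bigl _ _ (@loops_frustrated k)).
transitivity (\prod_v \sum_(x : spin Q k | (tagged x).1 \in ~: loop_fixed (tag x) v)
    'X_(tag x) : {mpoly int[p]}).
  by rewrite bigA_distr_big_dep; apply: eq_bigl => s; apply/forallP/familyP.
apply: eq_bigr => v _; apply: etrans (sum_spin k (fun i => ~: loop_fixed i v) (fun i => 'X_i)) _.
by apply: eq_bigr => i _; rewrite muln1.
Qed.

Lemma leading_expr_neq0 : chi_poly a Phi T B != 0 -> leading_expr a Phi != 0.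
Proof.
apply: contra_neq => lead0; apply: mpoly_nat_eq0 => k; rewrite chi_poly_eval.
(* Polynomials over the integers form a domain, so the factor of some vertex vanishes. *)
have /eqP := lead0; rewrite leading_exprE => /prodf_eq0[v _ /eqP fv0].
have allfix i : ~: loop_fixed i v = set0.
  apply/eqP; rewrite -cards_eq0 -eqz_nat -natz; apply/eqP.
  have := congr1 (mcoeff U_(i)) fv0;
  rewrite mcoeff0 raddf_sum (bigD1 i) //= mcoeffMn mcoeffXU eqxx big1 ?addr0 // => j /negPf ji.
  by rewrite mcoeffMn mcoeffXU ji mul0rn.
apply/eqP; rewrite eqz_nat cards_eq0; apply/eqP/setP=> s; rewrite !inE.
apply/negP; rewrite totally_frustratedE => /eqP s0.
have := loops_frustrated s; rewrite s0 set0I eqxx => /esym/forallP/(_ v).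
by rewrite allfix inE.
Qed.

(** [msize] is the total degree plus one. Each term has degree [#|B A|], at most [#|V|], and the
    homogeneous part of degree [#|V|] is nonzero. *)
Lemma msize_chi_poly : chi_poly a Phi T B != 0 -> msize (chi_poly a Phi T B) = #|V|.+1.
Proof.
move=> /leading_expr_neq0; rewrite -pihomog_chi_poly => lead0.
apply/eqP; rewrite eqn_leq; apply/andP; split.
  rewrite msizeE; apply/bigmax_leqP_seq => m + _; rewrite mcoeff_msupp ltnS.
  apply: contraR; rewrite -ltnNge => ltm.
  rewrite raddf_sum big1 // => A _; rewrite /= mcoeffZ.
  rewrite (dhomog_nemf_coeff (chi_poly_term_homog A)) ?mulr0 // gtn_eqF //.
  exact: leq_ltn_trans (max_card _) ltm.
move: lead0; apply: contraNT; rewrite -leqNgt => ltP.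
rewrite pihomogE big_seq_cond big1 // => m /andP[/msize_mdeg_lt mP /eqP dm].
by move: (leq_trans mP ltP); rewrite dm ltnn.
Qed.

End ChromaticPolynomial.

Theorem theorem5 (G : groupType) (p : nat) (Q : 'I_p -> finType)
    (a : forall i : 'I_p, right_action G (Q i))
    (V E : finType) (Phi : gain_graph G V E)
    (T : {set E} -> {set E})
    (hT : forall A : {set E}, maximal_forest Phi A (T A))
    (B : {set E} -> {set V})
    (hB : forall A : {set E},
       is_transversal (B A) (components Phi A) [set: V]) :
  (forall k : 'I_p -> nat,
     (chi Phi (spin_action a k))%:Z
       = (chi_poly a Phi T B).@[fun i => (k i)%:Z])
  /\ (chi_poly a Phi T B != 0 ->
      msize (chi_poly a Phi T B) = #|V|.+1
      /\ pihomog mdeg #|V| (chi_poly a Phi T B) = leading_expr a Phi).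
Proof.
split=> [k|nz]; first by rewrite chi_poly_eval.
by split; [apply: msize_chi_poly | apply: pihomog_chi_poly].
Qed.
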